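(* For integers $n>3$ and $m>3$, the automorphism group of the cyclic simplicial rook graph satisfies $\mathbf{Aut}(\mathcal{CSR}(m,n))\cong \mathcal{S}_m\times \mathbb{Z}_n^{\times}\times \mathbb{Z}_n^{m-1}$.
   Context: For positive integers $m,n$, the cyclic simplicial rook graph $\mathcal{CSR}(m,n)$ is the graph whose vertices are the vectors $(a_1,\dots,a_m)\in\mathbb{Z}_n^m$ with $a_1+\cdots+a_m\equiv 0 \pmod n$, two vertices being adjacent if and only if their vectors differ in exactly two coordinates. $\mathcal{S}_m$ is the symmetric group on $m$ elements, $\mathbb{Z}_n^{\times}$ is the multiplicative group of integers modulo $n$ (residues coprime to $n$), and $\mathbb{Z}_n^{m-1}$ is the additive group.
   Formalization: The direct product is false as written (the automorphism group has centre of order at most 2); the formal theorem proves that it is the semidirect product of the normal subgroup Z_n^{m-1} of translations with S_m × Z_n^× (coordinate permutations and unit scalings). *)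

(* Defs.v *)
From mathcomp Require Import all_boot all_order all_algebra all_fingroup all_solvable.
Set Implicit Arguments. Unset Strict Implicit. Unset Printing Implicit Defensive.
Import GRing.Theory.

(* Vertices of CSR(m,n): vectors (a_1..a_m) in Z_n^m with zero coordinate sum.
   ('Z_n is Z/nZ as soon as n >= 2; the theorem assumes n > 3.) *)
Definition csr_vertex (m n : nat) :=
  {x : {ffun 'I_m -> 'Z_n} | (\sum_(i < m) x i == 0)%R}.

Definition csr_adj (m n : nat) (x y : csr_vertex m n) : bool :=
  #|[set i : 'I_m | val x i != val y i]| == 2.

Definition csr_aut (m n : nat) : {set {perm csr_vertex m n}} :=
  [set f : {perm csr_vertex m n} |
     [forall x, forall y, csr_adj (f x) (f y) == csr_adj x y]].

Definition csr_coordperm (m n : nat) : {set {perm csr_vertex m n}} :=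
  [set f : {perm csr_vertex m n} | [exists s : 'S_m,
     [forall x, val (f x) == [ffun i => val x (s i)]]]].

Definition csr_scaling (m n : nat) : {set {perm csr_vertex m n}} :=
  [set f : {perm csr_vertex m n} | [exists u : {unit 'Z_n},
     [forall x, val (f x) == [ffun i => (val u * val x i)%R]]]].

Definition csr_translation (m n : nat) : {set {perm csr_vertex m n}} :=
  [set f : {perm csr_vertex m n} | [exists t : csr_vertex m n,
     [forall x, val (f x) == (val x + val t)%R]]].

(* Main.v *)
Require Import Defs.
From mathcomp Require Import all_boot all_order all_algebra all_fingroup all_solvable.
From mathcomp Require Import ring zify.

Set Implicit Arguments. Unset Strict Implicit. Unset Printing Implicit Defensive.
Import GRing.Theory.

(* The neighbours of x are the x + a (e_i - e_j).  For two neighbours y, z of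
   x, the coordinate pairs in which they differ from x are disjoint iff y and z
   are distinct, non-adjacent, and have at most one common neighbour w <> x that
   is not adjacent to x; in that case w = y + z - x.  So an automorphism f
   preserves disjointness, hence equality, of the coordinate pairs at each
   vertex x.  The induced map on pairs preserves stars, because a star mapped to
   a triangle would force 1 = -1 in Z_n; it therefore comes from a permutation
   s_x of the coordinates, and comparing adjacent neighbours of x gives
   f (x + a (e_i - e_j)) = f x + h_x(a) (e_(s_x i) - e_(s_x j)).  Triangles and
   the parallelograms x, y, z, y + z - x show that s_x and h_x do not depend on
   x.  Then h is additive, so f is a coordinate permutation composed with a
   scaling and a translation. *)

(** * Shifts in a group and small finite sets *)

Lemma neq_addr (T : zmodType) (u a : T) : (a != 0 -> u != u + a)%R.
Proof. by rewrite -{1}(addr0 u) (inj_eq (addrI u)) eq_sym. Qed.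

Lemma neq_subr (T : zmodType) (u a : T) : (a != 0 -> u != u - a)%R.
Proof. by move=> a0; rewrite neq_addr ?oppr_eq0. Qed.

Lemma card_split_cover (T : finType) (A B C : {set T}) :
  A \subset B :|: C -> B :&: C = set0 -> (#|A :&: B| + #|A :&: C|)%N = #|A|.
Proof.
move=> /setIidPl sA BC0; rewrite -cardsUI -setIUr sA.
by rewrite setIACA setIid BC0 setI0 cards0 addn0.
Qed.

Lemma eq_cardI (T : finType) (A B : {set T}) :
  #|A :&: B| = #|A| -> #|A| = #|B| -> A = B.
Proof.
move=> cAB cA; apply/eqP; rewrite eqEcard cA leqnn andbT.
by apply/setIidPl/eqP; rewrite eqEcard subsetIl cAB leqnn.
Qed.

Lemma set2_of_mem (T : finType) (A : {set T}) s t :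
  #|A| = 2 -> s \in A -> t \in A -> s != t -> A = [set s; t].
Proof.
move=> cA sA tA st; apply/eqP; rewrite eq_sym eqEcard cA cards2 st andbT.
by apply/subsetP => p; rewrite !inE => /orP[] /eqP->.
Qed.

Lemma set2_other (T : finType) (A : {set T}) s :
  #|A| = 2 -> s \in A -> exists2 t, s != t & A = [set s; t].
Proof.
move=> /eqP/cards2P[p [q [pq ->]]]; rewrite !inE => /orP[] /eqP->.
  by exists q.
by exists p; rewrite 1?eq_sym // setUC.
Qed.

(** * Vertices, moves along two coordinates, and adjacency *)

Section Moves.
Local Open Scope ring_scope.
Variables m n : nat.
Implicit Types (x y z w : csr_vertex m n) (i j k l : 'I_m) (a b c : 'Z_n).

Definition entry x i : 'Z_n := val x i.

Lemma csr_sum0 x : \sum_i entry x i = 0.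
Proof. by apply/eqP; apply: (valP x). Qed.

Definition diffset x y := [set i | entry x i != entry y i].

Definition move_fun x i j a : {ffun 'I_m -> 'Z_n} :=
  [ffun k => entry x k + (if k == i then a else 0) - (if k == j then a else 0)].

Lemma move_fun_sum0 x i j a : \sum_k move_fun x i j a k == 0.
Proof.
under eq_bigr do rewrite ffunE.
by rewrite sumrB big_split /= csr_sum0 -!big_mkcond !big_pred1_eq add0r subrr.
Qed.

(* The vertex [x + a (e_i - e_j)]. *)
Definition move x i j a : csr_vertex m n :=
  exist (fun g : {ffun 'I_m -> 'Z_n} => \sum_(i < m) g i == 0)
    (move_fun x i j a) (move_fun_sum0 x i j a).

Lemma moveE x i j a k : entry (move x i j a) k =
  entry x k + (if k == i then a else 0) - (if k == j then a else 0).
Proof. by rewrite /entry ffunE. Qed.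

Lemma vertexP x y : (forall k, entry x k = entry y k) -> x = y.
Proof. by move=> exy; apply/val_inj/ffunP. Qed.

Lemma moveN x i j a : move x j i (- a) = move x i j a.
Proof.
by apply: vertexP => k; rewrite !moveE; case: eqP => _; case: eqP => _; ring.
Qed.

Lemma move0 x i j : move x i j 0 = x.
Proof. by apply: vertexP => k; rewrite moveE !if_same addr0 subr0. Qed.

Lemma moveD x i j a b : move (move x i j a) i j b = move x i j (a + b).
Proof.
by apply: vertexP => k; rewrite !moveE; case: eqP => _; case: eqP => _; ring.
Qed.

Lemma moveC x i j k l a b :
  move (move x i j a) k l b = move (move x k l b) i j a.
Proof. by apply: vertexP => p; rewrite !moveE; ring. Qed.

Lemma move_chain x i j k a : move (move x i j a) j k a = move x i k a.
Proof. by apply: vertexP => p; rewrite !moveE; ring. Qed.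

Lemma move_first x i j a : i != j -> entry (move x i j a) i = entry x i + a.
Proof. by move=> ij; rewrite moveE eqxx (negPf ij) subr0. Qed.

Lemma move_second x i j a : i != j -> entry (move x i j a) j = entry x j - a.
Proof. by move=> ij; rewrite moveE eqxx eq_sym (negPf ij) addr0. Qed.

Lemma move_other x i j a k : k != i -> k != j ->
  entry (move x i j a) k = entry x k.
Proof. by move=> ki kj; rewrite moveE (negPf ki) (negPf kj) addr0 subr0. Qed.

Lemma diffset_move x i j a : i != j -> a != 0 ->
  diffset x (move x i j a) = [set i; j].
Proof.
move=> ij a0; apply/setP => k; rewrite !inE.
have [->|ki] := eqVneq k i; first by rewrite move_first // neq_addr.
have [->|kj] := eqVneq k j; first by rewrite move_second // neq_subr.
by rewrite move_other // eqxx.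
Qed.

Lemma adj_move x i j a : i != j -> a != 0 -> csr_adj x (move x i j a).
Proof.
by move=> ij a0; rewrite /csr_adj -/(diffset _ _) diffset_move // cards2 ij.
Qed.

(** Both vertices have zero sum, so the changes at [i] and [j] are opposite and a single scalar
    describes the edge. *)
Lemma diffset_moveP x y i j : i != j -> diffset x y = [set i; j] ->
  exists2 a, a != 0 & y = move x i j a.
Proof.
move=> ij dxy.
have out k : k != i -> k != j -> entry y k = entry x k.
  move=> ki kj; apply/eqP; move/setP/(_ k): dxy; rewrite !inE (negPf ki).
  by rewrite (negPf kj) eq_sym => /negbFE.
exists (entry y i - entry x i).
  rewrite subr_eq0 eq_sym; move/setP/(_ i): dxy; by rewrite !inE eqxx.
have : \sum_k (entry y k - entry x k) = 0 by rewrite sumrB !csr_sum0 subrr.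
rewrite (bigD1 i) //= (bigD1 j) 1?eq_sym //=.
rewrite big1 => [|k /andP[ki kj]]; last first.
  by rewrite out // subrr.
rewrite addr0 => /eqP; rewrite addr_eq0 => /eqP s0; apply: vertexP => k.
have [->|ki] := eqVneq k i; first by rewrite move_first // addrC subrK.
have [->|kj] := eqVneq k j; last by rewrite move_other // out.
rewrite move_second // s0; ring.
Qed.

Lemma adjP x y : csr_adj x y ->
  exists i j a, [/\ i != j, a != 0 & y = move x i j a].
Proof.
rewrite /csr_adj -/(diffset _ _) => /cards2P[i [j [ij dxy]]].
by have [a a0 ->] := diffset_moveP ij dxy; exists i, j, a; split.
Qed.

Lemma nadj3 x y i j k : i != j -> i != k -> j != k ->
  entry x i != entry y i -> entry x j != entry y j -> entry x k != entry y k ->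
  ~~ csr_adj x y.
Proof.
move=> ij ik jk hi hj hk; rewrite /csr_adj -/(diffset _ _).
have : [set i; j; k] \subset diffset x y.
  by apply/subsetP => l; rewrite !inE => /orP[/orP[]|] /eqP->.
move/subset_leq_card; rewrite setUC cardsU1 cards2 !inE ij negb_or.
by rewrite eq_sym ik eq_sym jk; case: #|_| => [|[|[|]]].
Qed.

Lemma adj_star x i j k a : i != j -> i != k -> j != k -> a != 0 ->
  csr_adj (move x i j a) (move x i k a).
Proof. by move=> *; rewrite -(move_chain x i j k) adj_move. Qed.

(** If [a] and [b] were distinct, the two vertices would differ in all three of [i], [j] and [k]. *)
Lemma adj_star_eq x i j k a b : i != j -> i != k -> j != k -> a != 0 ->
  b != 0 -> csr_adj (move x i j a) (move x i k b) -> a = b.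
Proof.
move=> ij ik jk a0 b0; apply: contraTeq => ab; apply: (nadj3 ij ik jk).
- by rewrite !move_first // (inj_eq (addrI _)).
- by rewrite move_second // move_other 1?eq_sym ?neq_subr // eq_sym.
- by rewrite [X in _ != X]move_second // move_other ?neq_subr // eq_sym.
Qed.

Lemma move_inj x i j a b : i != j -> move x i j a = move x i j b -> a = b.
Proof.
move=> ij /(congr1 (fun y : csr_vertex m n => entry y i)).
by rewrite !move_first // => /addrI.
Qed.

(** * Disjointness of coordinate pairs, read off from adjacency *)

Definition opposite x y z w :=
  [&& csr_adj y w, csr_adj z w, w != x & ~~ csr_adj x w].

(** Phrased with equality and adjacency alone, so that automorphisms preserve it; [indepE] gives its
    meaning for neighbours of [x]. *)
Definition indep x y z := [&& y != z, ~~ csr_adj y z &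
  [forall w, forall w', opposite x y z w ==> opposite x y z w' ==> (w == w')]].

Lemma opposite_move x i j k l a b :
  i != j -> k != l -> i != k -> i != l -> j != k -> j != l ->
  a != 0 -> b != 0 ->
  opposite x (move x i j a) (move x k l b) (move (move x i j a) k l b).
Proof.
move=> ij kl ik il jk jl a0 b0.
have dxi : entry x i != entry (move (move x i j a) k l b) i.
  by rewrite move_other // move_first // neq_addr.
apply/and4P; split; first by rewrite adj_move.
- by rewrite moveC adj_move.
- by apply: contraNneq dxi => ->.
- apply: (nadj3 ij ik jk) => //.
    by rewrite move_other // move_second // neq_subr.
  by rewrite moveC move_other 1?eq_sym // 1?eq_sym // move_first ?neq_addr.
Qed.

(** A count of coordinates. On [S :|: T] the vertices [y] and [z] differ, so [w] differs there from
    at least one of them; as [U] and [W] have two elements each, they partition these four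
    coordinates. It remains to see that [U = T] and [W = S]. *)
Lemma opposite_disjoint x y z w : csr_adj x y -> csr_adj x z ->
  [disjoint diffset x y & diffset x z] -> opposite x y z w ->
  forall k, entry w k = entry y k + entry z k - entry x k.
Proof.
rewrite /opposite /csr_adj -!/(diffset _ _) => /eqP cS /eqP cT dST.
case/and4P=> /eqP cU /eqP cW wx nxw.
set S := diffset x y in cS dST; set T := diffset x z in cT dST.
set U := diffset y w in cU; set W := diffset z w in cW.
have ST0 : S :&: T = set0 by apply/eqP; rewrite setI_eq0.
have cST : #|S :|: T| = 4 by rewrite cardsU cS cT ST0 cards0.
have TS i : i \in T -> i \notin S.
  move=> iT; apply/negP => iS; move/setP/(_ i): ST0.
  by rewrite in_setI iS iT inE.
have sub : S :|: T \subset U :|: W.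
  apply/subsetP => i; rewrite inE => /orP[] iST.
    have := contraL (TS i) iST; move: iST; rewrite !inE => + /negbNE/eqP <-.
    case: (eqVneq (entry x i) (entry w i)) => [<-|];
      by rewrite ?orbT // eq_sym => ->.
  have := TS _ iST; move: iST; rewrite !inE => + /negbNE/eqP <-.
  case: (eqVneq (entry x i) (entry w i)) => [<-|] //.
  by rewrite eq_sym => ->; rewrite orbT.
have := subset_leq_card sub; rewrite cST cardsU cU cW => le4.
have UW0 : U :&: W = set0.
  by apply: cards0_eq; move: le4; case: #|_| => [|[|[|[|]]]].
have cUW : #|U :|: W| = 4 by rewrite cardsU cU cW UW0 cards0.
have eUW : S :|: T = U :|: W by apply/eqP; rewrite eqEcard sub cUW cST.
have outST i : i \notin S :|: T -> entry x i = entry w i.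
  rewrite inE negb_or => iST.
  have : i \notin U :|: W by rewrite -eUW inE negb_or.
  move: iST; rewrite !inE negb_or => /andP[/negbNE/eqP-> _].
  by case/andP => /negbNE/eqP.
have zS i : i \in S -> entry z i = entry x i.
  by move=> iS; apply/esym/eqP; move: (contraL (@TS i) iS); rewrite inE negbK.
have yT i : i \in T -> entry y i = entry x i.
  by move=> iT; apply/esym/eqP; move: (TS _ iT); rewrite inE negbK.
(* On [S] the entries of [z] and [x] agree, so [w] departs from [x] there exactly when it departs
   from [z]; likewise on [T] with [y]. *)
have dxw : diffset x w = (S :&: W) :|: (T :&: U).
  apply/setP => i; case: (boolP (i \in S :|: T)) => iST; last first.
    move: (iST); rewrite inE negb_or => /andP[/negPf iS /negPf iT].
    by rewrite inE (outST _ iST) eqxx in_setU !in_setI iS iT.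
  move: iST; rewrite in_setU => /orP[] iST.
    rewrite in_setU !in_setI iST (negPf (contraL (@TS i) iST)) orbF.
    by rewrite 2!inE zS.
  by rewrite in_setU !in_setI iST (negPf (TS _ iST)) /= 2!inE yT.
have WS := card_split_cover (A := W) (B := S) (C := T).
rewrite eUW subsetUr in WS; have {}WS := WS isT ST0.
have TU := card_split_cover (A := T) (B := U) (C := W).
rewrite -eUW subsetUr in TU; have {}TU := TU isT UW0.
have cdxw : #|diffset x w| = (#|W :&: S| + #|T :&: U|)%N.
  by rewrite dxw cardsU setIACA ST0 set0I cards0 subn0 [S :&: W]setIC.
have nw0 : #|diffset x w| != 0.
  rewrite cards_eq0; apply: contraNneq wx => d0; apply/eqP/vertexP => k.
  by move/setP/(_ k): d0; rewrite !inE => /negbFE/eqP.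
(* Both numbers equal [2 - #|W :&: T|], so their sum is even; nonadjacency excludes 2 and [w != x]
   excludes 0. *)
have [cWS cTU] : #|W :&: S| = 2 /\ #|T :&: U| = 2.
  rewrite [T :&: W]setIC in TU; rewrite cT in TU; rewrite cW in WS.
  rewrite cdxw in nxw nw0; move: nxw nw0 TU WS.
  by move: #|W :&: S| #|T :&: U| #|W :&: T| => p q r; lia.
have eW : W = S by apply: eq_cardI; rewrite ?cWS ?cW ?cS.
have eU : U = T by apply: eq_cardI; rewrite 1?setIC ?cTU ?cU ?cT.
have wy k : k \notin T -> entry w k = entry y k.
  by rewrite -eU inE negbK => /eqP.
have wz k : k \notin S -> entry w k = entry z k.
  by rewrite -eW inE negbK => /eqP.
move=> k; case: (boolP (k \in T)) => kT.
  by rewrite wz ?TS // yT // addrC addrA addNr add0r.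
rewrite wy //; case: (boolP (k \in S)) => kS; first by rewrite zS // addrK.
by move: kT; rewrite inE negbK => /eqP ->; rewrite addrK.
Qed.

Lemma diffset_adjP x y : csr_adj x y ->
  exists i j, i != j /\ diffset x y = [set i; j].
Proof. by rewrite /csr_adj -/(diffset _ _) => /cards2P. Qed.

Lemma opposite_sym x y z w : opposite x y z w = opposite x z y w.
Proof. by rewrite /opposite; do !case: csr_adj. Qed.

(** This opposite vertex changes the entry at [i] by [a]; exchanging the roles of [j] and [k] gives
    one that changes it by [b]. So uniqueness fails when the pairs share one coordinate. *)
Lemma opposite_star x i j k a b : i != j -> i != k -> j != k -> a != 0 ->
  b != 0 -> a != b ->
  opposite x (move x i j a) (move x i k b) (move (move x i j a) j k b).
Proof.
move=> ij ik jk a0 b0 ab.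
have [ji ki kj] : [/\ j != i, k != i & k != j] by split; rewrite eq_sym.
set y := move x i j a; set w := move y j k b.
have dxw : entry x i != entry w i.
  by rewrite move_other // move_first // neq_addr.
apply/and4P; split; first by rewrite adj_move.
- have -> : w = move (move x i k b) i j (a - b).
    apply: vertexP => p; rewrite !moveE.
    by case: (p == i); case: (p == j); ring.
  by rewrite adj_move // subr_eq0.
- by apply: contraNneq dxw => ->.
apply: (nadj3 ij ik jk) => //.
  rewrite move_first // move_second // -addrA neq_addr //.
  by rewrite addrC subr_eq0 eq_sym.
by rewrite move_second // move_other // neq_subr.
Qed.

Lemma indep_star x i j k a b : i != j -> i != k -> j != k -> a != 0 ->
  b != 0 -> ~~ indep x (move x i j a) (move x i k b).
Proof.
move=> ij ik jk a0 b0; rewrite /indep.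
have [->|ab] := eqVneq a b; first by rewrite adj_star ?andbF.
have kj : k != j by rewrite eq_sym.
rewrite !negb_and; apply/orP; right; apply/orP; right.
have opp := opposite_star x ij ik jk a0 b0 ab.
have := opposite_star x ik ij kj b0 a0; rewrite eq_sym ab => /(_ isT).
rewrite opposite_sym => opp'.
apply: contraNN ab => /forallP/(_ _)/forallP/(_ _)/implyP/(_ opp)/implyP.
move=> /(_ _ opp')/eqP/(congr1 (fun w => entry w i)).
rewrite ![entry (move (move _ _ _ _) _ _ _) _]move_other //.
by rewrite !move_first // => /addrI ->.
Qed.

Lemma indepE x y z : csr_adj x y -> csr_adj x z ->
  indep x y z = [disjoint diffset x y & diffset x z].
Proof.
move=> xy xz; apply/idP/idP => [|dis]; last first.
  have yz : y != z.
    apply: contraTneq dis => <-; rewrite -setI_eq0 setIid -cards_eq0.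
    by move: xy; rewrite /csr_adj -/(diffset _ _) => /eqP->.
  have nyz : ~~ csr_adj y z.
    move: xy xz dis => /adjP[i [j [a [ij a0 ->]]]] /adjP[k [l [b [kl b0 ->]]]].
    rewrite !diffset_move // -setI_eq0 => /eqP/setP dis.
    have := dis i; have := dis j; rewrite !inE !eqxx orbT !andTb.
    move=> /negbT; rewrite negb_or => /andP[jk jl] /negbT.
    rewrite negb_or => /andP[ik il]; apply: (nadj3 ij ik jk).
    - by rewrite move_first // move_other // eq_sym neq_addr.
    - by rewrite move_second // move_other // eq_sym neq_subr.
    - by rewrite [X in _ != X]move_first // move_other ?neq_addr // eq_sym.
  rewrite /indep yz nyz; apply/forallP => w; apply/forallP => w'.
  apply/implyP => ow; apply/implyP => ow'; apply/eqP/vertexP => k.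
  by rewrite (opposite_disjoint xy xz dis ow) (opposite_disjoint xy xz dis ow').
apply: contraTT.
move: xy xz => /adjP[i [j [a [ij a0 ->]]]] /adjP[k [l [b [kl b0 ->]]]].
rewrite !diffset_move // -setI_eq0 => /set0Pn[p].
rewrite !inE => /andP[pij pkl].
(* By [moveN] a move can be reversed, so here and in the next reduction the shared coordinate
   becomes the first one. *)
wlog pi : i j a ij a0 pij / p = i => [IH|].
  case/orP: (pij) => /eqP ep; first exact: IH.
  by rewrite -moveN; apply: IH; rewrite ?oppr_eq0 // 1?[j == i]eq_sym // orbC.
wlog pk : k l b kl b0 pkl / p = k => [IH|].
  case/orP: (pkl) => /eqP ep; first exact: IH.
  rewrite -(moveN _ k).
  by apply: IH; rewrite ?oppr_eq0 // 1?[l == k]eq_sym // orbC.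
move: ij kl; rewrite -pk -pi => ij kl.
have [<-|jl] := eqVneq j l; last exact: indep_star.
(* The pairs coincide: the two neighbours are equal, or adjacent through a move by [b - a]. *)
rewrite /indep; have [-> //|ab] := eqVneq a b; first by rewrite eqxx.
rewrite -[b](subrK a) addrC -moveD adj_move ?andbF //.
by rewrite subr_eq0 eq_sym.
Qed.

End Moves.

(** * Free coordinates and connectedness of the graph *)

Section Automorphism.
Local Open Scope ring_scope.
Variables m n : nat.
Hypothesis hm : (3 < m)%N.
Implicit Types (x y z w : csr_vertex m n) (i j k l : 'I_m) (a b c : 'Z_n).

Lemma fresh3 i j k : exists l, [/\ l != i, l != j & l != k].
Proof.
have /card_gt0P[l] : (0 < #|~: [set i; j; k]|)%N.
  rewrite cardsCs setCK card_ord subn_gt0 (leq_ltn_trans _ hm) //.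
  by rewrite setUC cardsU1 cards2; lia.
by rewrite !inE !negb_or => /andP[/andP[li lj] lk]; exists l.
Qed.

Lemma exists_neq : exists i j : 'I_m, i != j.
Proof.
have m0 : (0 < m)%N by apply: leq_trans hm.
have [i [ne _ _]] := fresh3 (Ordinal m0) (Ordinal m0) (Ordinal m0).
by exists i, (Ordinal m0).
Qed.

Hypothesis hn : (3 < n)%N.

Lemma Zn_two_neq0 : 1 + 1 != 0 :> 'Z_n.
Proof.
apply/eqP => /(congr1 (@nat_of_ord _)); rewrite -[1 + 1]/(2%:R).
by rewrite val_Zp_nat ?modn_small //; lia.
Qed.

(** Connectedness as an induction principle, on the number of coordinates in which [x] and [x0]
    differ. *)
Lemma path_ind x0 (P : csr_vertex m n -> Prop) :
  P x0 -> (forall x i j a, i != j -> P x -> P (move x i j a)) -> forall x, P x.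
Proof.
move=> P0 Pmove x; have [d] := ubnP #|diffset x0 x|.
elim: d x => // d IHd x; rewrite ltnS => le_d.
have [d0|/set0Pn[i di]] := eqVneq (diffset x0 x) set0.
  rewrite (_ : x = x0) //; apply: vertexP => k.
  by move/setP/(_ k): d0; rewrite !inE => /negbFE/eqP.
(* Both sums vanish, so a difference at [i] alone is impossible. *)
have [j ji dj] : exists2 j, j != i & j \in diffset x0 x.
  apply/exists_inP; apply: contraTT di => /exists_inPn nd.
  have : \sum_k (entry x k - entry x0 k) = 0 by rewrite sumrB !csr_sum0 subrr.
  rewrite (bigD1 i) //= big1 => [|k /nd]; last first.
    by rewrite inE negbK => /eqP->; rewrite subrr.
  by rewrite addr0 => /eqP; rewrite subr_eq0 inE eq_sym negbK.
(* Undoing [a] restores the entry of [x0] at [i], and otherwise touches only [j], which is a place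
   of difference already. *)
set a := entry x i - entry x0 i.
rewrite -[x](move0 _ i j) -(addNr a) -moveD.
apply: Pmove; first by rewrite eq_sym.
rewrite -moveN opprK; apply: IHd; apply: leq_trans le_d.
apply: proper_card; apply/properP; split; last first.
  by exists i; rewrite // inE move_second // opprB addrCA subrr addr0 eqxx.
apply/subsetP => k; have [->|kj] := eqVneq k j; first by [].
have [->|ki] := eqVneq k i; first by [].
by rewrite !inE move_other.
Qed.

(** * Automorphisms and equality of coordinate pairs *)

Variable f : {perm csr_vertex m n}.
Hypothesis f_adj : forall x y, csr_adj (f x) (f y) = csr_adj x y.

Lemma opposite_aut x y z w :
  opposite (f x) (f y) (f z) (f w) = opposite x y z w.
Proof. by rewrite /opposite !f_adj (inj_eq perm_inj). Qed.

Lemma indep_aut x y z : indep (f x) (f y) (f z) = indep x y z.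
Proof.
rewrite /indep (inj_eq perm_inj) f_adj; congr [&& _, _ & _].
apply/forallP/forallP => H w; apply/forallP => w'.
  move/forallP/(_ (f w')): (H (f w)).
  by rewrite !opposite_aut (inj_eq perm_inj).
rewrite -(permKV f w) -(permKV f w') !opposite_aut (inj_eq perm_inj).
by move/forallP: (H ((f^-1)%g w)).
Qed.

(** A pair is determined by the pairs disjoint from it: for [p] in the second pair but not in the
    first pair [{i, j}], and a fourth coordinate [q], the pair [{p, q}] meets the second and misses
    the first. *)
Lemma diffset_eqP x y y' : csr_adj x y -> csr_adj x y' ->
  reflect (forall z, csr_adj x z -> indep x y z = indep x y' z)
          (diffset x y == diffset x y').
Proof.
move=> xy xy'; apply: (iffP eqP) => [e z xz|H]; first by rewrite !indepE // e.
apply/eqP; rewrite eq_sym eqEcard; move: (xy) (xy').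
rewrite /csr_adj -!/(diffset _ _) => /eqP-> /eqP->; rewrite leqnn andbT.
apply/subsetP => p py'; apply/negPn/negP => py.
have [i [j [ij dxy]]] := diffset_adjP xy.
have [q [qi qj qp]] := fresh3 i j p.
have pq : p != q by rewrite eq_sym.
have xz : csr_adj x (move x p q 1) by apply: adj_move => //; apply: oner_neq0.
have := H _ xz; rewrite !indepE // diffset_move ?oner_neq0 // -!setI_eq0.
suff [-> /negPf->] : diffset x y :&: [set p; q] == set0 /\
    diffset x y' :&: [set p; q] != set0 by [].
split; last by apply/set0Pn; exists p; rewrite in_setI py' !inE eqxx.
apply/eqP/setP => r; rewrite in_setI dxy in_set0; move: py.
rewrite dxy !inE negb_or => /andP[pi pj]; apply/negbTE/negP => /andP[].
by case/orP => /eqP-> /orP[] /eqP e; move: pi pj qi qj; rewrite -e eqxx.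
Qed.

Lemma diffset_aut_eq x y y' : csr_adj x y -> csr_adj x y' ->
  (diffset (f x) (f y) == diffset (f x) (f y')) = (diffset x y == diffset x y').
Proof.
move=> xy xy'; apply/diffset_eqP/diffset_eqP; rewrite ?f_adj // => H z.
  by rewrite -!(indep_aut x) -(f_adj x) => /H.
rewrite -(permKV f z) f_adj !indep_aut; apply: H.
Qed.

(** * Local form of an automorphism at one vertex *)

Section AtVertex.
Variable x : csr_vertex m n.

(** The step 1 is a representative: by [image_pairE] every nonzero step along [i], [j] gives the
    same pair. *)
Definition image_pair i j := diffset (f x) (f (move x i j 1)).

Lemma image_pairE i j a : i != j -> a != 0 ->
  diffset (f x) (f (move x i j a)) = image_pair i j.
Proof.
move=> ij a0; apply/eqP; rewrite diffset_aut_eq ?adj_move ?oner_neq0 //.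
by rewrite !diffset_move ?oner_neq0.
Qed.

Lemma image_pairC i j : i != j -> image_pair i j = image_pair j i.
Proof.
move=> ij; have ji : j != i by rewrite eq_sym.
by rewrite -(image_pairE (a := -1)) ?oppr_eq0 ?oner_neq0 // moveN.
Qed.

Lemma card_image_pair i j : i != j -> #|image_pair i j| = 2.
Proof.
move=> ij; have := adj_move x ij (oner_neq0 'Z_n).
by rewrite -f_adj /csr_adj => /eqP.
Qed.

Lemma image_pair_inj i j k : i != j -> i != k -> j != k ->
  image_pair i j != image_pair i k.
Proof.
move=> ij ik jk; rewrite diffset_aut_eq ?adj_move ?oner_neq0 //.
rewrite !diffset_move ?oner_neq0 //; apply/eqP => /setP/(_ j).
by rewrite !inE eqxx orbT eq_sym (negPf ij) (negPf jk).
Qed.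

Lemma image_pair_disjoint i j k l : i != j -> k != l -> i != k -> i != l ->
  j != k -> j != l -> [disjoint image_pair i j & image_pair k l].
Proof.
move=> ij kl ik il jk jl; rewrite -indepE ?f_adj ?adj_move ?oner_neq0 //.
rewrite indep_aut indepE ?adj_move ?oner_neq0 // !diffset_move ?oner_neq0 //.
rewrite -setI_eq0; apply/eqP/setP => p; rewrite !inE.
apply/negbTE/negP => /andP[].
by case/orP => /eqP-> /orP[] /eqP e; move: ik il jk jl; rewrite e eqxx.
Qed.

Lemma image_pair_meet i j k : i != j -> i != k -> j != k ->
  exists s, s \in image_pair i j /\ s \in image_pair i k.
Proof.
move=> ij ik jk; have := indep_star x ij ik jk (oner_neq0 _) (oner_neq0 _).
rewrite -indep_aut indepE ?f_adj ?adj_move ?oner_neq0 // -setI_eq0.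
by case/set0Pn => s; rewrite in_setI => /andP[]; exists s.
Qed.

(* Otherwise the three pairs form a triangle [st, sr, tr].  The vertices
   adjacent to [f x + e_s - e_t] on the lines [sr] and [tr] through [f x] are
   [f x + e_s - e_r] and [f x - e_t + e_r]; these are not adjacent since
   [1 <> -1], although the corresponding preimages are. *)
Lemma image_pair_star i j k l s : i != j -> i != k -> i != l ->
  j != k -> j != l -> k != l ->
  s \in image_pair i j -> s \in image_pair i k -> s \in image_pair i l.
Proof.
move=> ij ik il jk jl kl sj sk; apply/negPn/negP => sl.
have [t st Dij] := set2_other (card_image_pair ij) sj.
have [r sr Dik] := set2_other (card_image_pair ik) sk.
have tr : t != r.
  by apply: contraNneq (image_pair_inj ij ik jk) => tr; rewrite Dij Dik tr.
have tl : t \in image_pair i l.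
  have [p []] := image_pair_meet ij il jl.
  by rewrite Dij => /set2P[] -> // sil; case/negP: sl.
have rl : r \in image_pair i l.
  have [p []] := image_pair_meet ik il kl.
  by rewrite Dik => /set2P[] -> // sil; case/negP: sl.
have Dil := set2_of_mem (card_image_pair il) tl rl tr.
have one0 := oner_neq0 'Z_n.
pose y := (f^-1)%g (move (f x) s t 1).
have fy : f y = move (f x) s t 1 by rewrite permKV.
have xy : csr_adj x y by rewrite -f_adj fy adj_move.
have /eqP dxy : diffset x y == [set i; j].
  rewrite -(diffset_move x ij one0) -diffset_aut_eq ?adj_move //.
  by rewrite fy diffset_move // -Dij.
have [c c0 yE] := diffset_moveP ij dxy.
have [b b0 fk] := diffset_moveP sr (etrans (image_pairE ik c0) Dik).
have [d d0 fl] := diffset_moveP tr (etrans (image_pairE il c0) Dil).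
have ts : t != s by rewrite eq_sym.
have rs : r != s by rewrite eq_sym.
have rt : r != t by rewrite eq_sym.
have mone0 : - 1 != 0 :> 'Z_n by rewrite oppr_eq0.
have b1 : 1 = b.
  apply: (adj_star_eq (x := f x) st sr tr) => //.
  by rewrite -fy -fk f_adj yE adj_star.
have d1 : - 1 = d.
  apply: (adj_star_eq (x := f x) ts tr sr) => //.
  by rewrite moveN -fy -fl f_adj yE adj_star.
have : - b = - d.
  apply: (adj_star_eq (x := f x) rs rt st); rewrite ?oppr_eq0 //.
  by rewrite !moveN -fk -fl f_adj adj_star.
rewrite -b1 -d1 => /eqP; rewrite opprK eq_sym -subr_eq0 opprK.
by rewrite (negPf Zn_two_neq0).
Qed.

(** A common element of the images of two pairs through [i] serves for all the others by
    [image_pair_star]. *)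
Lemma image_pair_center i : exists s, forall j, i != j -> s \in image_pair i j.
Proof.
have [j [ji _ _]] := fresh3 i i i; have [k [ki kj _]] := fresh3 i j j.
have [ij ik jk] : [/\ i != j, i != k & j != k] by split; rewrite eq_sym.
have [s [sj sk]] := image_pair_meet ij ik jk; exists s => l il.
have [<-//|jl] := eqVneq j l; have [<-//|kl] := eqVneq k l.
exact: (image_pair_star ij ik).
Qed.

Lemma image_pair_perm : exists2 s : 'I_m -> 'I_m, injective s &
  forall i j, i != j -> image_pair i j = [set s i; s j].
Proof.
have [s sP] := fin_all_exists image_pair_center.
(* If [s i = s j], the images of the disjoint pairs [{i, k}] and [{j, l}] would share this
   element. *)
have s_inj : injective s.
  move=> i j sij; apply/eqP/negPn/negP => ij.
  have [k [ki kj _]] := fresh3 i j j; have [l [li lj lk]] := fresh3 i j k.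
  have [ik jl il jk kl] : [/\ i != k, j != l, i != l, j != k & k != l].
    by split; rewrite eq_sym.
  have kj' : k != j by rewrite eq_sym.
  have := image_pair_disjoint ik jl ij il kj' kl.
  rewrite -setI_eq0 => /eqP/setP/(_ (s i)); rewrite in_setI sP // sij sP //.
  by rewrite inE.
exists s => // i j ij; apply: set2_of_mem; rewrite ?card_image_pair ?sP //.
  by rewrite image_pairC // sP // eq_sym.
by rewrite (inj_eq s_inj).
Qed.

Lemma local_form : exists s : 'I_m -> 'I_m, exists h : 'Z_n -> 'Z_n,
  injective s /\
  forall i j a, i != j -> f (move x i j a) = move (f x) (s i) (s j) (h a).
Proof.
have [s s_inj sP] := image_pair_perm.
(* The length of the image step, read at [s i]; it will turn out to depend on [a] alone. *)
pose g i j a := entry (f (move x i j a)) (s i) - entry (f x) (s i).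
have gP i j a : i != j -> f (move x i j a) = move (f x) (s i) (s j) (g i j a).
  move=> ij; rewrite /g; have [->|a0] := eqVneq a 0.
    by rewrite !move0 subrr move0.
  have sij : s i != s j by rewrite (inj_eq s_inj).
  have [c c0 ->] := diffset_moveP sij (etrans (image_pairE ij a0) (sP _ _ ij)).
  by rewrite move_first // addrC addKr.
have g_neq0 i j a : i != j -> a != 0 -> g i j a != 0.
  move=> ij; apply: contraNneq => g0; apply/eqP/(@move_inj _ _ x i j) => //.
  by apply: (@perm_inj _ f); rewrite gP // g0 !move0.
have gN i j a : i != j -> g j i (- a) = - g i j a.
  move=> ij; have ji : j != i by rewrite eq_sym.
  apply: (@move_inj _ _ (f x) (s j) (s i)); first by rewrite (inj_eq s_inj).
  by rewrite moveN -!gP // moveN.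
(* Equal steps from [i] towards [j] and [k] end in adjacent vertices; their images are adjacent too,
   which forces equal lengths. *)
have g2 i j k a : i != j -> i != k -> g i j a = g i k a.
  move=> ij ik; have [->//|jk] := eqVneq j k; have [->|a0] := eqVneq a 0.
    by rewrite /g !move0.
  apply: (@adj_star_eq _ _ (f x) (s i) (s j) (s k));
    rewrite ?(inj_eq s_inj) ?g_neq0 //.
  by rewrite -!gP // f_adj adj_star.
have g1 i j k a : i != j -> k != j -> g i j a = g k j a.
  move=> ij kj; have [ji jk] : j != i /\ j != k by split; rewrite eq_sym.
  by apply: oppr_inj; rewrite -!gN //; apply: g2.
have [i0 [j0 ij0]] := exists_neq.
exists s, (g i0 j0); split=> // i j a ij; rewrite gP //; congr (move _ _ _ _).
(* The pairs [(i, j)] and [(i0, j0)] are linked through [(k, j)] and [(k, j0)]. *)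
have [k [kj kj0 ki0]] := fresh3 j j0 i0.
rewrite (g1 i j k) // (g2 k j j0) //; exact: g1.
Qed.

End AtVertex.

(** * Constancy of the local form along edges *)

Definition local_at x (s : 'I_m -> 'I_m) (h : 'Z_n -> 'Z_n) :=
  forall i j a, i != j -> f (move x i j a) = move (f x) (s i) (s j) (h a).

Section LocalScale.
Variables (s : 'I_m -> 'I_m) (h : 'Z_n -> 'Z_n) (x : csr_vertex m n).
Hypotheses (s_inj : injective s) (fx : local_at x s h).

Lemma local_scale0 : h 0 = 0.
Proof.
have [i [j ij]] := exists_neq.
apply: (@move_inj _ _ (f x) (s i) (s j)).
  by rewrite (inj_eq s_inj).
by rewrite -fx // !move0.
Qed.

Lemma local_scale_neq0 a : a != 0 -> h a != 0.
Proof.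
have [i [j ij]] := exists_neq.
apply: contraNneq => g0; apply/eqP/(@move_inj _ _ x i j) => //.
by apply: (@perm_inj _ f); rewrite fx // g0 !move0.
Qed.

End LocalScale.

Section Neighbour.
Variables (s s' : 'I_m -> 'I_m) (h h' : 'Z_n -> 'Z_n) (x : csr_vertex m n).
Variables (i j : 'I_m) (a : 'Z_n).
Let y := move x i j a.
Hypotheses (s_inj : injective s) (fx : local_at x s h).
Hypotheses (s'_inj : injective s') (fy : local_at y s' h').
Hypotheses (ij : i != j) (a0 : a != 0).

(** In the triangle [x], [y], [move x i k a], the edge at [y] is a move along [j], [k]; its image is
    computed from the local forms at [x] and at [y]. *)
Lemma propagate_pair k : i != k -> j != k -> [set s' j; s' k] = [set s j; s k].
Proof.
move=> ik jk.
have fyk : f (move y j k a) = move (f y) (s j) (s k) (h a).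
  by rewrite /y move_chain !fx // move_chain.
rewrite -(diffset_move (f y) (a := h' a)) ?(inj_eq s'_inj) //; last first.
  exact: local_scale_neq0 fy _ a0.
by rewrite -fy // fyk diffset_move ?(inj_eq s_inj) ?(local_scale_neq0 fx).
Qed.

Lemma propagate_second : s' j = s j.
Proof.
have [k [ki kj _]] := fresh3 i j j; have [l [li lj lk]] := fresh3 i j k.
have [ik jl il jk] : [/\ i != k, j != l, i != l & j != k].
  by split; rewrite eq_sym.
have /setP/(_ (s j)) := propagate_pair ik jk.
have /setP/(_ (s j)) := propagate_pair il jl.
(* [s j] lies in both [{s' j, s' k}] and [{s' j, s' l}], which share only [s' j]. *)
rewrite !inE eqxx /= => /orP[/eqP->//|/eqP el] /orP[/eqP->//|/eqP ek].
by move: lk; rewrite -(inj_eq s'_inj) -el -ek eqxx.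
Qed.

Lemma propagate_other k : i != k -> j != k -> s' k = s k.
Proof.
move=> ik jk; have /setP/(_ (s k)) := propagate_pair ik jk.
rewrite !inE eqxx orbT propagate_second (inj_eq s_inj) eq_sym (negPf jk).
by move/eqP.
Qed.

End Neighbour.

Lemma local_at_move s h x i j a : injective s -> local_at x s h -> i != j ->
  local_at (move x i j a) s h.
Proof.
move=> s_inj fx ij; have [->|a0] := eqVneq a 0; first by rewrite move0.
set y := move x i j a; have [s' [h' [s'_inj fy]]] := local_form y.
have ji : j != i by rewrite eq_sym.
have es k : s' k = s k.
  have [->|kj] := eqVneq k j.
    exact: (propagate_second s_inj fx s'_inj fy).
  have [->|ki] := eqVneq k i; last first.
    by apply: (propagate_other s_inj fx s'_inj fy); rewrite // eq_sym.
  (* Reversing the move makes [i] its second coordinate. *)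
  have fy' : local_at (move x j i (- a)) s' h' by rewrite moveN.
  by apply: (propagate_second s_inj fx s'_inj fy'); rewrite ?oppr_eq0.
have eh b : h' b = h b.
  have [->|b0] := eqVneq b 0.
    by rewrite (local_scale0 s_inj fx) (local_scale0 s'_inj fy).
  have [k [ki kj _]] := fresh3 i j j; have [l [li lj lk]] := fresh3 i j k.
  have [ik jl il jk] : [/\ i != k, j != l, i != l & j != k].
    by split; rewrite eq_sym.
  have kl : k != l by rewrite eq_sym.
  have xy : csr_adj x y by apply: adj_move.
  have xz : csr_adj x (move x k l b) by apply: adj_move.
  (* The fourth corner of this parallelogram goes to the fourth corner of the image parallelogram;
     the entry at [s k] then compares [h' b] with [h b]. *)
  have opp := opposite_move x ij kl ik il jk jl a0 b0.
  have dis : [disjoint diffset (f x) (f y) & diffset (f x) (f (move x k l b))].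
    rewrite !image_pairE //; exact: image_pair_disjoint.
  rewrite -opposite_aut in opp.
  have := opposite_disjoint _ _ dis opp (s k); rewrite !f_adj => /(_ xy xz).
  rewrite fy // (fx k l b kl) !es !move_first ?(inj_eq s_inj) // => e.
  apply: (addrI (entry (f y) (s k))); rewrite e; ring.
by move=> k l b kl; rewrite fy // !es eh.
Qed.

(** By connectedness one [s] and one [h] serve at every vertex. Composing moves along one line makes
    [h] additive, hence multiplication by [h 1]. *)
Lemma aut_affine x0 : exists s : 'I_m -> 'I_m, exists2 u : 'Z_n,
  injective s /\ u \is a GRing.unit &
  forall x k, entry (f x) (s k) =
    u * (entry x k - entry x0 k) + entry (f x0) (s k).
Proof.
have [s [h [s_inj fx0]]] := local_form x0.
have fx : forall x, local_at x s h.
  apply: (path_ind (x0 := x0)) => // x i j a ij fx; exact: local_at_move.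
have [i0 [j0 ij0]] := exists_neq.
have hD a b : h (a + b) = h a + h b.
  apply: (@move_inj _ _ (f x0) (s i0) (s j0)).
    by rewrite (inj_eq s_inj).
  by rewrite -moveD -!fx // moveD.
have hE a : h a = h 1 * a.
  rewrite -[a]natr_Zp; elim: (a : nat) => [|p IHp].
    by rewrite mulr0 (local_scale0 s_inj fx0).
  by rewrite mulrSr hD IHp mulrDr mulr1.
exists s, (h 1).
  (* An injective multiplication on a finite ring is bijective, and the preimage of 1 inverts
     [h 1]. *)
  split=> //; have h_inj : injective (fun a => h 1 * a).
    move=> a b /= /eqP; rewrite -subr_eq0 -mulrBr -hE => /eqP h0.
    apply/eqP; rewrite -subr_eq0; apply: contraTT isT.
    move=> /(local_scale_neq0 fx0); by rewrite h0 eqxx.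
  have [g _ gK] := injF_bij h_inj.
  by apply/unitrPr; exists (g 1); rewrite gK.
apply: (path_ind (x0 := x0)) => [k|x i j a ij IH k].
  by rewrite subrr mulr0 add0r.
rewrite (fx x) // !moveE IH !(inj_eq s_inj) (hE a); do 2!case: eqP => _; ring.
Qed.

End Automorphism.

(** * Translations, coordinate permutations and scalings as group morphisms *)

Section Groups.
Local Open Scope ring_scope.
Variables m n : nat.
Implicit Types (x y z t : csr_vertex m.+1 n) (i j k l : 'I_m.+1).
Implicit Types (s : 'S_m.+1) (u : {unit 'Z_n}) (v : 'rV['Z_n]_m).
Local Notation V := (csr_vertex m.+1 n).

Fact mk_vertex_sum0 (g : 'I_m.+1 -> 'Z_n) :
  \sum_i g i = 0 -> \sum_i [ffun j => g j] i == 0.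
Proof.
move=> g0; apply/eqP; rewrite -[RHS]g0.
by apply: eq_bigr => i _; rewrite ffunE.
Qed.

Definition mk_vertex g (g0 : \sum_i g i = 0) : V :=
  exist (fun g : {ffun 'I_m.+1 -> 'Z_n} => \sum_i g i == 0)
    [ffun j => g j] (mk_vertex_sum0 g0).

Lemma mk_vertexE g g0 k : entry (@mk_vertex g g0) k = g k.
Proof. by rewrite /entry ffunE. Qed.

Fact translate_sum0 t x : \sum_i (entry x i + entry t i) = 0.
Proof. by rewrite big_split /= !csr_sum0 addr0. Qed.

Fact permute_sum0 s x : \sum_i entry x ((s^-1)%g i) = 0.
Proof. exact: etrans (esym (reindex_perm (s^-1)%g)) (csr_sum0 x). Qed.

Fact scale_sum0 u x : \sum_i (val u * entry x i) = 0.
Proof. by rewrite -mulr_sumr csr_sum0 mulr0. Qed.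

Fact zero_sum0 : \sum_(i < m.+1) (0 : 'Z_n) = 0.
Proof. by rewrite big1. Qed.

Fact opp_sum0 x : \sum_i - entry x i = 0.
Proof. by rewrite sumrN csr_sum0 oppr0. Qed.

Definition vertex0 : V := mk_vertex zero_sum0.
Definition vertexN x : V := mk_vertex (opp_sum0 x).

Fact translate_inj t : injective (fun x => mk_vertex (translate_sum0 t x)).
Proof.
move=> x y exy; apply: vertexP => k; apply: (addIr (entry t k)).
by move/(congr1 (@entry _ _ ^~ k)): exy; rewrite !mk_vertexE.
Qed.

Fact permute_inj s : injective (fun x => mk_vertex (permute_sum0 s x)).
Proof.
move=> x y exy; apply: vertexP => k.
by move/(congr1 (@entry _ _ ^~ (s k))): exy; rewrite !mk_vertexE permK.
Qed.

Fact scale_inj u : injective (fun x => mk_vertex (scale_sum0 u x)).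
Proof.
move=> x y exy; apply: vertexP => k; apply: (mulrI (valP u)).
by move/(congr1 (@entry _ _ ^~ k)): exy; rewrite !mk_vertexE.
Qed.

Definition translate t : {perm V} := perm (@translate_inj t).
(** Products of permutations apply the left factor first; the inverse in [permute_sum0] therefore
    makes [permute] a morphism. *)
Definition permute s : {perm V} := perm (@permute_inj s).
Definition scale u : {perm V} := perm (@scale_inj u).

Lemma translateE t x k : entry (translate t x) k = entry x k + entry t k.
Proof. by rewrite permE mk_vertexE. Qed.

Lemma permuteE s x k : entry (permute s x) k = entry x ((s^-1)%g k).
Proof. by rewrite permE mk_vertexE. Qed.

Lemma scaleE u x k : entry (scale u x) k = val u * entry x k.
Proof. by rewrite permE mk_vertexE. Qed.

Fact row_sum0 v : \sum_i
  (if unlift ord_max i is Some j then v 0 j else - \sum_j v 0 j) = 0.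
Proof.
rewrite (bigD1_ord ord_max) //= unlift_none.
by under [X in _ + X]eq_bigr do rewrite liftK; rewrite addNr.
Qed.

(** Parametrizes the vertices by their entries off [ord_max], so that translations are indexed by
    the additive group of rows. *)
Definition vertex_of_row v : V := mk_vertex (row_sum0 v).

Lemma vertex_of_rowD v w k : entry (vertex_of_row (v + w)) k =
  entry (vertex_of_row v) k + entry (vertex_of_row w) k.
Proof.
rewrite !mk_vertexE; case: unlift => [j/=|/=]; first by rewrite mxE.
by rewrite -opprD -big_split; under eq_bigr do rewrite mxE.
Qed.

Lemma vertex_of_row_inj : injective vertex_of_row.
Proof.
move=> v w evw; apply/rowP => j.
move/(congr1 (@entry _ _ ^~ (lift ord_max j))): evw.
by rewrite !mk_vertexE liftK.
Qed.

Lemma vertex_of_row_surj t : exists v, t = vertex_of_row v.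
Proof.
exists (\row_j entry t (lift ord_max j)); apply: vertexP => k.
rewrite mk_vertexE.
case: unliftP => [j ->|->]; first by rewrite mxE.
under eq_bigr do rewrite mxE.
apply/eqP; rewrite -addr_eq0; apply/eqP; rewrite -[RHS](csr_sum0 t).
by rewrite [RHS](bigD1_ord ord_max).
Qed.

Lemma permuteM : {in [set: 'S_m.+1] &, {morph permute : s s' / (s * s')%g}}.
Proof.
move=> s s' _ _; apply/permP => x; apply: vertexP => k.
by rewrite permM !permuteE invMg permM.
Qed.

Lemma scaleM : {in [set: {unit 'Z_n}] &, {morph scale : u u' / (u * u')%g}}.
Proof.
move=> u u' _ _; apply/permP => x; apply: vertexP => k.
by rewrite permM !scaleE FinRing.val_unitM mulrCA mulrA.
Qed.

Definition translate_row v := translate (vertex_of_row v).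

Lemma translate_rowM :
  {in [set: 'rV['Z_n]_m] &, {morph translate_row : v w / (v * w)%g}}.
Proof.
move=> v w _ _; apply/permP => x; apply: vertexP => k.
by rewrite permM !translateE vertex_of_rowD addrA.
Qed.

Canonical permute_morphism := Morphism permuteM.
Canonical scale_morphism := Morphism scaleM.
Canonical translate_morphism := Morphism translate_rowM.

Lemma translationE : csr_translation m.+1 n = (translate_row @* setT)%g.
Proof.
apply/setP => f; rewrite inE.
apply/existsP/morphimP => [[t /forallP ft]|[v _ _ ->]].
  have [v tv] := vertex_of_row_surj t; exists v; rewrite ?inE //.
  apply/permP => x; apply: vertexP => k.
  by rewrite /= /translate_row -tv translateE {1}/entry (eqP (ft x)) ffunE.
exists (vertex_of_row v); apply/forallP => x; apply/eqP/ffunP => k.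
by rewrite [LHS]translateE ffunE.
Qed.

Lemma coordpermE : csr_coordperm m.+1 n = (permute @* setT)%g.
Proof.
apply/setP => f; rewrite inE.
apply/existsP/morphimP => [[s /forallP fs]|[s _ _ ->]].
  (* [csr_coordperm] composes with [s], whereas [permute] composes with the inverse. *)
  exists (s^-1)%g; rewrite ?inE //; apply/permP => x; apply: vertexP => k.
  by rewrite /= permuteE {1}/entry (eqP (fs x)) ffunE invgK.
exists (s^-1)%g; apply/forallP => x; apply/eqP/ffunP => k.
by rewrite [LHS]permuteE ffunE.
Qed.

Lemma scalingE : csr_scaling m.+1 n = (scale @* setT)%g.
Proof.
apply/setP => f; rewrite inE.
apply/existsP/morphimP => [[u /forallP fu]|[u _ _ ->]].
  exists u; rewrite ?inE //; apply/permP => x; apply: vertexP => k.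
  by rewrite /= scaleE {1}/entry (eqP (fu x)) ffunE.
exists u; apply/forallP => x; apply/eqP/ffunP => k.
by rewrite [LHS]scaleE ffunE.
Qed.

Lemma translate_mem t : translate t \in (translate_row @* setT)%g.
Proof.
by have [v ->] := vertex_of_row_surj t; apply/morphimP; exists v; rewrite ?inE.
Qed.

Lemma entry_vertex0 k : entry vertex0 k = 0.
Proof. by rewrite mk_vertexE. Qed.

Lemma translate_adj t x y :
  csr_adj (translate t x) (translate t y) = csr_adj x y.
Proof.
rewrite /csr_adj -!/(diffset _ _); congr (#|pred_of_set _| == 2).
by apply/setP => k; rewrite !inE !translateE (inj_eq (addIr _)).
Qed.

Lemma scale_adj u x y : csr_adj (scale u x) (scale u y) = csr_adj x y.
Proof.
rewrite /csr_adj -!/(diffset _ _); congr (#|pred_of_set _| == 2).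
by apply/setP => k; rewrite !inE !scaleE (inj_eq (mulrI (valP u))).
Qed.

Lemma permute_adj s x y : csr_adj (permute s x) (permute s y) = csr_adj x y.
Proof.
rewrite /csr_adj -!/(diffset _ _).
rewrite -(card_imset (mem (diffset x y)) (@perm_inj _ s)).
congr (#|pred_of_set _| == 2); apply/setP => k.
by rewrite -[k in RHS](permKV s) (mem_imset _ _ perm_inj) !inE !permuteE.
Qed.

(** Conjugating the translation by [t] with such an additive [f] gives the translation by [f t]. *)
Lemma normalise_translations (f : {perm V}) :
  (forall t x k, entry (f (translate t x)) k = entry (f x) k + entry (f t) k) ->
  f \in 'N(translate_row @* setT)%g.
Proof.
move=> fD; rewrite inE; apply/subsetP => g /imsetP[_ /morphimP[v _ _ ->] ->].
rewrite (_ : (_ ^ f)%g = translate (f (vertex_of_row v))) ?translate_mem //.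
apply/permP => x; apply: vertexP => k.
by rewrite conjgE !permM fD permKV translateE.
Qed.

End Groups.

(** * Semidirect decomposition of the automorphism group *)

Section Structure.
Local Open Scope ring_scope.
Variables m n : nat.
Hypotheses (hn : (3 < n)%N) (hm : (3 < m.+1)%N).

(** Test vertices that tell two coordinates apart; a third coordinate [p] absorbs the entry [-1]. *)
Lemma exists_entry (i k : 'I_m.+1) : i != k ->
  exists x : csr_vertex m.+1 n, entry x i = 1 /\ entry x k = 0.
Proof.
move=> ik; have [p [pi pk _]] := fresh3 hm i k k.
exists (move (vertex0 m n) i p 1).
rewrite move_first 1?eq_sym // move_other 1?eq_sym // 1?eq_sym //.
by rewrite !entry_vertex0 add0r.
Qed.

Local Open Scope group_scope.

Lemma permute_injm : 'injm (permute_morphism m n).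
Proof.
apply/injmP => s s' _ _ /= ess; apply: invg_inj; apply/permP => k.
apply/eqP/negPn/negP => /exists_entry[x [x1 x0]].
have := congr1 (fun f : {perm _} => entry (f x) k) ess.
by rewrite /= !permuteE x1 x0 => /eqP; rewrite oner_eq0.
Qed.

Lemma scale_injm : 'injm (scale_morphism m n).
Proof.
apply/injmP => u u' _ _ /= euu; apply: val_inj.
have [l [l0 _ _]] := fresh3 hm ord0 ord0 ord0.
have [x [x1 _]] := exists_entry l0.
have := congr1 (fun f : {perm _} => entry (f x) l) euu.
by rewrite /= !scaleE x1 !mulr1.
Qed.

Lemma translate_injm : 'injm (translate_morphism m n).
Proof.
apply/injmP => v w _ _ /= evw; apply: vertex_of_row_inj; apply: vertexP => k.
have := congr1 (fun f : {perm _} => entry (f (vertex0 m n)) k) evw.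
by rewrite /= !translateE !entry_vertex0 !add0r.
Qed.

Let T := translate_morphism m n @* setT.
Let S := permute_morphism m n @* setT.
Let U := scale_morphism m n @* setT.

Lemma scale_sub_cent : U \subset 'C(S).
Proof.
apply/centsP => _ /morphimP[u _ _ ->] _ /morphimP[s _ _ ->].
by apply/permP => x; apply: vertexP => k; rewrite !permM /= !(permuteE, scaleE).
Qed.

(** The intersection is trivial: scalings preserve zero entries, while a nontrivial permutation
    carries an entry 1 of some vertex to the place of an entry 0. *)
Lemma permute_scale_dprod : S \x U = S * U.
Proof.
apply: dprodE scale_sub_cent _.
apply/trivgP/subsetP => f /setIP[/morphimP[s _ _ ->] /morphimP[u _ _ su]].
rewrite (_ : s = 1); first by rewrite morph1 inE.
apply: invg_inj; apply/permP => k; rewrite invg1 perm1; apply/eqP/negPn/negP.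
move=> /exists_entry[x [x1 x0]].
have := congr1 (fun f : {perm _} => entry (f x) k) su.
by rewrite /= permuteE scaleE x1 x0 mulr0 => /eqP; rewrite oner_eq0.
Qed.

Lemma permute_scale_norm : S * U \subset 'N(T).
Proof.
apply: mul_subG; apply/subsetP => _ /morphimP[z _ _ ->];
  apply: normalise_translations => t x k; rewrite /=.
  by rewrite !permuteE translateE.
by rewrite !scaleE translateE mulrDr.
Qed.

(** Permutations and scalings fix the zero vertex, and a translation fixing it is the identity. *)
Lemma translate_permute_scale_sdprod : T ><| (S \x U) = T * (S * U).
Proof.
(* [sdprodE] expects groups, so the product set is replaced by the join. *)
have SU := cent_joinEr scale_sub_cent.
rewrite permute_scale_dprod -SU.
apply: sdprodE; first by rewrite /= SU permute_scale_norm.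
apply/trivgP; rewrite /= SU; apply/subsetP => f /setIP[/morphimP[v _ _ ->]].
case/mulsgP => _ _ /morphimP[s _ _ ->] /morphimP[u _ _ ->] vsu.
rewrite inE; apply/eqP/permP => x; apply: vertexP => k.
rewrite perm1 /= translateE.
have := congr1 (fun f : {perm _} => entry (f (vertex0 m n)) k) vsu.
rewrite /= permM translateE scaleE permuteE !entry_vertex0 add0r mulr0 => ->.
by rewrite addr0.
Qed.

Lemma csr_autE : csr_aut m.+1 n = T * (S * U).
Proof.
apply/setP => f; rewrite inE; apply/idP/mulsgP => [/forallP f_adj|]; last first.
  case=> _ _ /morphimP[v _ _ ->]
    /mulsgP[_ _ /morphimP[s _ _ ->] /morphimP[u _ _ ->] ->] ->.
  apply/forallP => x; apply/forallP => y; rewrite !permM /=.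
  by rewrite scale_adj permute_adj translate_adj.
have {}f_adj x y : csr_adj (f x) (f y) = csr_adj x y.
  by have /forallP/(_ y)/eqP := f_adj x.
(* As [f x0] is the zero vertex, the affine form has no constant term: [f] subtracts [x0], permutes,
   then scales. *)
pose x0 := f^-1 (vertex0 m n).
have [s [u [s_inj uu] fE]] := aut_affine hm hn f_adj x0.
pose p := @permute m n (perm s_inj); pose q := @scale m n (FinRing.Unit uu).
exists (translate (vertexN x0)) (p * q).
- exact: translate_mem.
- by apply: mem_mulg; apply: mem_morphim; rewrite inE.
apply/permP => x; apply: vertexP => k.
rewrite !permM scaleE permuteE translateE mk_vertexE.
rewrite -{1}(permKV (perm s_inj) k) permE fE permKV entry_vertex0.
by rewrite addr0.
Qed.

End Structure.

Local Open Scope group_scope.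

Theorem theorem7 (m n : nat) (hn : 3 < n) (hm : 3 < m) :
  [/\ csr_translation m n ><| (csr_coordperm m n \x csr_scaling m n)
        = csr_aut m n,
      csr_coordperm m n \isog [set: 'S_m],
      csr_scaling m n \isog units_Zp n
    & csr_translation m n \isog [set: 'rV['Z_n]_(m.-1)]].
Proof.
(* Passing to a successor matches [m.-1] with the length of the rows that index translations. *)
case: m hm => // m hm.
rewrite translationE coordpermE scalingE (csr_autE hn hm).
split; first exact: translate_permute_scale_sdprod.
- by rewrite isog_sym sub_isog ?permute_injm.
- by rewrite isog_sym sub_isog ?scale_injm.
- by rewrite isog_sym sub_isog ?translate_injm.
Qed.
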